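(* Let $A, B, C, D \in \mathcal{C}_2(\mathcal{H})$ and let $0\leq \nu \leq 1$. Then $$w_{(2,\nu)}^2\left(\begin{bmatrix} A & B \\ C & D \end{bmatrix}\right) \leq w_{(2,\nu)}^2(A) + w_{(2,\nu)}^2(D) + \|B\|_{2}^2 + \|C\|_{2}^2.$$
   Context: $\mathcal{H}$ is a complex Hilbert space. For a complex Hilbert space $\mathcal{K}$, $\mathcal{C}_2(\mathcal{K})$ is the Hilbert--Schmidt class, i.e. the bounded linear operators $T$ on $\mathcal{K}$ with $\|T\|_2=\sqrt{\mathrm{tr}(T^*T)}<\infty$. For $0\leq\nu\leq1$ and $T\in\mathcal{C}_2(\mathcal{K})$, define $$w_{(2,\nu)}(T)=\sup_{\theta\in\mathbb{R}}\left\|\nu e^{i\theta}T+(1-\nu)e^{-i\theta}T^*\right\|_2,$$ and $w_{(2,\nu)}^2(T)$ means $\left(w_{(2,\nu)}(T)\right)^2$. The $2\times2$ operator matrix acts on $\mathcal{H}\oplus\mathcal{H}$, and $w_{(2,\nu)}$ of it is taken with $\mathcal{K}=\mathcal{H}\oplus\mathcal{H}$. *)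

(* Defs.v *)
From HB Require Import structures.
From mathcomp Require Import all_boot all_order all_algebra.
From mathcomp Require Import all_classical all_reals ring lra.
From mathcomp Require Import ereal topology normedtype esum trigo.
From mathcomp Require Import complex.

Set Implicit Arguments.
Unset Strict Implicit.
Unset Printing Implicit Defensive.

Import Order.TTheory GRing.Theory Num.Theory.
Import numFieldNormedType.Exports.

Local Open Scope classical_set_scope.
Local Open Scope complex_scope.
Local Open Scope ring_scope.

(* The inner product is linear in its first argument and conjugate-linear in
   its second one; completeness comes from completeNormedModType. *)
HB.mixin Record isHilbert (R : realType) H & CompleteNormedModule R[i] H := {
  hdot : {dot H for (@Num.conj R[i])};
  hdot_norm : forall x : H, `|x| ^+ 2 = hdot x x
}.

#[short(type="hilbertType")]
HB.structure Definition Hilbert (R : realType) :=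
  {H of isHilbert R H & CompleteNormedModule R[i] H}.

(* Orthogonal direct sum.  The alias is needed because the library already
   equips the product type with the max norm. *)
Definition hsum (H1 H2 : Type) : Type := (H1 * H2)%type.

Section hilbert_sum.
Variables (R : realType) (H1 H2 : hilbertType R).
Local Notation C := R[i].

HB.instance Definition _ := GRing.Lmodule.copy (hsum H1 H2) (H1 * H2)%type.

Definition hsum_norm (x : hsum H1 H2) : C :=
  sqrtC (`|x.1| ^+ 2 + `|x.2| ^+ 2).

Let arg_ge0 (a b : C) : 0 <= a -> 0 <= b -> 0 <= a ^+ 2 + b ^+ 2.
Proof. by move=> a0 b0; rewrite addr_ge0// exprn_ge0. Qed.

Let le_sqrt (a b : C) : 0 <= b -> a ^+ 2 <= b ^+ 2 -> 0 <= a -> a <= b.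
Proof. by move=> b0 + a0; rewrite ler_pXn2r// nnegrE. Qed.

Let minkowski (a b c d : C) : 0 <= a -> 0 <= b -> 0 <= c -> 0 <= d ->
  sqrtC ((a + c) ^+ 2 + (b + d) ^+ 2) <=
  sqrtC (a ^+ 2 + b ^+ 2) + sqrtC (c ^+ 2 + d ^+ 2).
Proof.
move=> a0 b0 c0 d0.
have N0 : 0 <= sqrtC (a ^+ 2 + b ^+ 2) by rewrite sqrtC_ge0 arg_ge0.
have M0 : 0 <= sqrtC (c ^+ 2 + d ^+ 2) by rewrite sqrtC_ge0 arg_ge0.
apply: le_sqrt; rewrite ?addr_ge0// ?sqrtC_ge0 ?arg_ge0 ?addr_ge0//.
rewrite sqrtCK [leRHS]sqrrD !sqrtCK !sqrrD.
rewrite -subr_ge0.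
set N := sqrtC _; set M := sqrtC (c ^+ 2 + _).
rewrite [X in 0 <= X](_ : _ = (N * M - (a * c + b * d)) *+ 2); last first.
  by rewrite !mulr2n; ring.
rewrite mulrn_wge0// subr_ge0; apply: le_sqrt.
- by rewrite mulr_ge0.
- rewrite exprMn !sqrtCK -subr_ge0.
  rewrite [X in 0 <= X](_ : _ = (a * d - b * c) ^+ 2); last by ring.
  by rewrite real_exprn_even_ge0// realB// ger0_real// mulr_ge0.
- by rewrite addr_ge0// mulr_ge0.
Qed.

Let hsum_ler_normD (x y : hsum H1 H2) :
  hsum_norm (x + y) <= hsum_norm x + hsum_norm y.
Proof.
apply: le_trans (minkowski _ _ _ _); rewrite ?normr_ge0//.
rewrite /hsum_norm; apply: le_sqrt; rewrite ?sqrtC_ge0 ?arg_ge0 ?addr_ge0//.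
by rewrite !sqrtCK lerD// ler_pXn2r ?nnegrE ?addr_ge0 ?ler_normD.
Qed.

Let hsum_normrZ (l : C) (x : hsum H1 H2) :
  hsum_norm (l *: x) = `|l| * hsum_norm x.
Proof.
rewrite /hsum_norm /= !normrZ !exprMn -mulrDr sqrtCM ?nnegrE ?exprn_ge0 ?arg_ge0//.
by rewrite exprCK.
Qed.

Let hsum_normr0_eq0 (x : hsum H1 H2) : hsum_norm x = 0 -> x = 0.
Proof.
move/eqP; rewrite sqrtC_eq0 paddr_eq0 ?exprn_ge0// !sqrf_eq0 !normr_eq0.
by case: x => a b /= /andP[/eqP -> /eqP ->].
Qed.

HB.instance Definition _ := Lmodule_isNormed.Build C (hsum H1 H2)
  hsum_ler_normD hsum_normrZ hsum_normr0_eq0.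

Let hsum_normE (x : hsum H1 H2) : `|x| = hsum_norm x. Proof. by []. Qed.

Let hsum_sqr_norm (x : hsum H1 H2) : `|x| ^+ 2 = `|x.1| ^+ 2 + `|x.2| ^+ 2.
Proof. by rewrite hsum_normE sqrtCK. Qed.

Let norm1_le (x : hsum H1 H2) : `|x.1| <= `|x|.
Proof. by apply: le_sqrt => //; rewrite hsum_sqr_norm lerDl exprn_ge0. Qed.

Let norm2_le (x : hsum H1 H2) : `|x.2| <= `|x|.
Proof. by apply: le_sqrt => //; rewrite hsum_sqr_norm lerDr exprn_ge0. Qed.

Let norm_le (x : hsum H1 H2) : `|x| <= `|x.1| + `|x.2|.
Proof.
apply: le_sqrt; rewrite ?addr_ge0// hsum_sqr_norm sqrrD lerD2r lerDl.
by rewrite mulrn_wge0// mulr_ge0.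
Qed.

Let hsum_complete (F : set_system (hsum H1 H2)) :
  ProperFilter F -> cauchy F -> cvg F.
Proof.
move=> FF Fc.
have Fball : cauchy_ball F by apply/cauchy_ballP.
have c1 : cvg ((fun x : hsum H1 H2 => x.1) @ F).
  apply: cauchy_cvg; apply/cauchy_ballP => e e0.
  have [[A B] /= [FA FB] AB] := Fball e e0.
  exists ([set x.1 | x in A], [set x.1 | x in B]).
    by split; [apply: filterS FA|apply: filterS FB] => x Ax; exists x.
  move=> [_ _] /= [[x Ax <-] [y By <-]].
  have := AB (x, y) (conj Ax By); rewrite -!ball_normE /=.
  exact/le_lt_trans/(norm1_le (x - y)).
have c2 : cvg ((fun x : hsum H1 H2 => x.2) @ F).
  apply: cauchy_cvg; apply/cauchy_ballP => e e0.
  have [[A B] /= [FA FB] AB] := Fball e e0.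
  exists ([set x.2 | x in A], [set x.2 | x in B]).
    by split; [apply: filterS FA|apply: filterS FB] => x Ax; exists x.
  move=> [_ _] /= [[x Ax <-] [y By <-]].
  have := AB (x, y) (conj Ax By); rewrite -!ball_normE /=.
  exact/le_lt_trans/(norm2_le (x - y)).
move/cvg_ex : c1 => [l1 c1]; move/cvg_ex : c2 => [l2 c2].
apply/cvg_ex; exists ((l1, l2) : hsum H1 H2).
apply/(@cvgrPdist_lt _ _ _ F _ id) => e e0.
have e20 : 0 < e / 2 by rewrite divr_gt0.
move/cvgrPdist_lt : c1 => /(_ _ e20) c1.
move/cvgrPdist_lt : c2 => /(_ _ e20) c2.
apply: filterS2 c1 c2 => x /= x1 x2.
apply: le_lt_trans (norm_le _) _.
by rewrite [ltRHS]splitr ltrD.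
Qed.

HB.instance Definition _ :=
  Uniform_isComplete.Build (hsum H1 H2) hsum_complete.

Definition hsum_dot (x y : hsum H1 H2) : C :=
  hdot x.1 y.1 + hdot x.2 y.2.

Let hsum_dot_bilinear :
  bilinear_for *%R (@Num.conj C \; *%R) hsum_dot.
Proof.
by split=> [y a x z|x a y z]; rewrite /hsum_dot /=
  ?linearPl ?linearPr /= mulrDr addrACA.
Qed.

HB.instance Definition _ := bilinear_isBilinear.Build C (hsum H1 H2)
  (hsum H1 H2) C *%R (@Num.conj C \; *%R) hsum_dot hsum_dot_bilinear.

Let hsum_dotC (x y : hsum H1 H2) :
  hsum_dot x y = (-1) ^+ false * Num.conj (hsum_dot y x).
Proof.
by rewrite expr0 mul1r /hsum_dot rmorphD /= (hermC _ x.1) (hermC _ x.2) expr0 !mul1r.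
Qed.

HB.instance Definition _ := isHermitianSesquilinear.Build C (hsum H1 H2)
  false (@Num.conj C) hsum_dot hsum_dotC.

Let hsum_dot_norm (x : hsum H1 H2) : `|x| ^+ 2 = hsum_dot x x.
Proof. by rewrite hsum_sqr_norm /hsum_dot -!hdot_norm. Qed.

Let hsum_dot_gt0 (x : hsum H1 H2) : x != 0 -> 0 < hsum_dot x x.
Proof. by move=> x0; rewrite -hsum_dot_norm exprn_gt0// normr_gt0. Qed.

HB.instance Definition _ := isDotProduct.Build C (hsum H1 H2) hsum_dot
  hsum_dot_gt0.

HB.instance Definition _ := isHilbert.Build R (hsum H1 H2) hsum_dot_norm.

Lemma hsum_hdotE (x y : hsum H1 H2) :
  hdot x y = hdot x.1 y.1 + hdot x.2 y.2.
Proof. by []. Qed.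

End hilbert_sum.

Section operators.
Variables (R : realType) (H : hilbertType R).
Local Notation C := R[i].
Implicit Types (T S : H -> H) (E : set H).

Definition orthonormal_set E :=
  forall e f, E e -> E f -> hdot e f = (e == f)%:R.

(* An orthonormal basis is a maximal orthonormal set; its cardinality is
   arbitrary, so the space need not be separable. *)
Definition orthonormal_basis E :=
  orthonormal_set E /\ forall x, (forall e, E e -> hdot x e = 0) -> x = 0.

(* A fixed orthonormal basis, which exists by onbP. *)
Definition onb : set H := xget set0 orthonormal_basis.

Lemma onbP : orthonormal_basis onb.
Proof.
apply: xgetPex.
have [|E [oE maxE]] := @Zorn_bigcup H orthonormal_set.
  move=> F oF totF e f [A FA Ae] [B FB Bf].
  have [AB|BA] := totF _ _ FA FB; first by apply: (oF B FB) => //; exact: AB.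
  by apply: (oF A FA) => //; exact: BA.
exists E; split=> // x xE; apply/eqP/negPn/negP => x0.
have nx0 : `|x| != 0 by rewrite normr_eq0.
pose u := `|x|^-1 *: x.
have uE e : E e -> hdot u e = 0 by move=> Ee; rewrite linearZl_LR /= xE ?mulr0.
have Eu e : E e -> hdot e u = 0.
  by move=> Ee; rewrite hermC /= uE// conjC0 mulr0.
have uu : hdot u u = 1.
  by rewrite -hdot_norm normrZ normfV normr_id mulVf ?expr1n.
have nEu : ~ E u by move=> /uE; rewrite uu => /eqP; rewrite oner_eq0.
apply: (maxE (E `|` [set u])).
  by split; [exact: subsetUl|by move=> EuE; apply: nEu; apply: EuE; right].
move=> e f [Ee|->] [Ef|->].
- exact: oE.
- by rewrite Eu//; case: eqP => // eu; rewrite eu in Ee.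
- by rewrite uE//; case: eqP => // eu; rewrite -eu in Ef.
- by rewrite eqxx uu.
Qed.

Let proj_norm (x w : H) : `|w| = 1 ->
  `|x - hdot x w *: w| ^+ 2 = `|x| ^+ 2 - `|hdot x w| ^+ 2.
Proof.
move=> w1; rewrite !hdot_norm dnormB dnormZ -(hdot_norm w) w1 expr1n mulr1.
rewrite linearZr_LR /= mulrC -normCK rmorphXn /= conj_normC.
by rewrite opprD addrA addrK.
Qed.

Let unit_CS (x w : H) : `|w| = 1 -> `|hdot x w| <= `|x|.
Proof.
move=> w1; rewrite -(@ler_pXn2r _ 2) ?nnegrE// -subr_ge0 -proj_norm//.
Qed.

Let parallelogram (x y : H) :
  `|x - y| ^+ 2 = (`|x| ^+ 2 + `|y| ^+ 2) *+ 2 - `|x + y| ^+ 2.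
Proof. by rewrite !hdot_norm dnormB dnormD; ring. Qed.

Let q (x : H) : R := complex.Re (`|x| ^+ 2).

Let qE x : (q x)%:C = `|x| ^+ 2.
Proof.
by rewrite /q; apply/RRe_real; rewrite ger0_real// exprn_ge0.
Qed.

Let q_ge0 x : 0 <= q x. Proof. by rewrite -lecR qE exprn_ge0. Qed.

Lemma riesz (phi : H -> C) (M : C) : scalar phi ->
  (forall x, `|phi x| <= M * `|x|) -> exists z, forall x, phi x = hdot x z.
Proof.
move=> linphi phiM.
have phiB u v : phi (u - v) = phi u - phi v.
  by rewrite addrC -scaleN1r linphi mulN1r addrC.
have phiZ a u : phi (a *: u) = a * phi u.
  have phi0 : phi 0 = 0 by rewrite -[0 in LHS](subrr 0) phiB subrr.
  by rewrite -[a *: u]addr0 linphi phi0 addr0.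
have [phi0|/existsNP[x0 /eqP phix0]] := pselect (forall x, phi x = 0).
  by exists 0 => x; rewrite linear0r phi0.
pose K := [set x | phi x = 1].
have Kx0 : K ((phi x0)^-1 *: x0) by rewrite /K /= phiZ mulVf.
pose d := inf (q @` K).
have hi : has_inf (q @` K).
  split; first by exists (q ((phi x0)^-1 *: x0)), ((phi x0)^-1 *: x0).
  by exists 0 => _ [x _ <-].
have dK x : K x -> d <= q x.
  by move=> Kx; apply: ge_inf; [exact: hi.2|exists x].
have dKC x : K x -> d%:C <= `|x| ^+ 2 by move=> Kx; rewrite -qE lecR dK.
pose D e := [set x | K x /\ q x < d + e].
have Dne e : 0 < e -> D e !=set0.
  move=> e0; have [_ [x Kx <-] xd] := inf_adherent e0 hi.
  by exists x.
have Dmono e e' : e <= e' -> D e `<=` D e'.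
  by move=> ee' x [Kx xe]; split=> //; rewrite (lt_le_trans xe)// lerD2l.
pose F : set_system H := [set A | exists2 e, 0 < e & D e `<=` A].
have FF : ProperFilter F.
  split; first by move=> [e e0 De]; have [x /De] := Dne e e0.
  split; first by exists 1.
    move=> A B [e e0 eA] [f f0 fB]; exists (Num.min e f).
      by rewrite lt_min e0.
    move=> x Dx; split.
      by apply/eA/(Dmono _ _ _ _ Dx); rewrite ge_min lexx.
    by apply/fB/(Dmono _ _ _ _ Dx); rewrite ge_min lexx orbT.
  by move=> A B AB [e e0 eA]; exists e => //; exact: subset_trans AB.
have DD e x y : D e x -> D e y -> q (x - y) <= 4 * e.
  move=> [Kx xe] [Ky ye].
  have Kxy : K (2^-1 *: (x + y)).
    have {1}-> : x + y = (1 : C) *: x + y by rewrite scale1r.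
    rewrite /K /= phiZ linphi Kx Ky mulr1 -mulr2n -mulr_natr mul1r.
    by rewrite mulVf// pnatr_eq0.
  have := dK _ Kxy; rewrite -lecR qE normrZ normfV normr_nat exprMn => dxy.
  rewrite -lecR qE parallelogram.
  have {}dxy : (4 * d)%:C <= `|x + y| ^+ 2.
    rewrite rmorphM /= rmorph_nat -ler_pdivlMl ?ltr0n//.
    by apply: le_trans dxy _; rewrite exprVn -natrX.
  rewrite lerBlDr; apply: le_trans (lerD (lexx _) dxy).
  rewrite -!qE -!rmorphD /= -rmorphMn /= lecR mulr2n.
  by move/ltW: xe; move/ltW: ye; lra.
have Fc : cauchy F.
  apply/cauchy_ballP => e e0.
  have [r [r0 re]] : exists r : R, 0 < r /\ e = r%:C.
    exists (complex.Re e); have := RRe_real (gtr0_real e0) => ee.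
    by split=> //; rewrite -ltcR ee.
  have s0 : 0 < r ^+ 2 / 8 by rewrite divr_gt0// exprn_gt0.
  exists (D (r ^+ 2 / 8), D (r ^+ 2 / 8)); first by split; exists (r ^+ 2 / 8).
  move=> [x y] /= [Dx Dy]; rewrite -ball_normE /=.
  rewrite re -(@ltr_pXn2r _ 2) ?nnegrE// ?lecR ?(ltW r0)//.
  rewrite -qE -rmorphXn /= ltcR (le_lt_trans (DD _ _ _ Dx Dy))//.
  have : 0 < r ^+ 2 by rewrite exprn_gt0.
  lra.
move/cauchy_cvg/cvg_ex : Fc => [z /(@cvgrPdist_lt _ _ _ F _ id) Fz].
have phi_z : phi z = 1.
  apply/eqP; rewrite -subr_eq0 -normr_le0; apply/ler_addgt0Pr => e e0.
  rewrite add0r.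
  have [r r0 Dr] := Fz (e / (`|M| + 1)) (divr_gt0 e0 (ltr_wpDl (normr_ge0 M) ltr01)).
  have [x Dx] := Dne _ r0; have := Dr _ Dx => /= zx.
  have [Kx _] := Dx; rewrite -[X in phi z - X]Kx -phiB.
  apply: le_trans (phiM _) _.
  have M1 : 0 < `|M| + 1 by rewrite ltr_wpDl.
  apply: le_trans (_ : (`|M| + 1) * `|z - x| <= _); last first.
    by rewrite mulrC -ler_pdivlMr// ltW.
  apply: le_trans (real_ler_norm _) _.
    by rewrite ger0_real//; apply: le_trans (phiM (z - x)).
  by rewrite normrM normr_id ler_wpM2r// lerDl.
have orth w : phi w = 0 -> hdot z w = 0.
  have [->|w0] := eqVneq w 0; first by rewrite linear0r.
  move=> phiw; have nw0 : `|w| != 0 by rewrite normr_eq0.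
  pose u := `|w|^-1 *: w.
  have u1 : `|u| = 1 by rewrite normrZ normfV normr_id mulVf.
  have phiu : phi u = 0 by rewrite phiZ phiw mulr0.
  suff zu : hdot z u = 0.
    by rewrite -[w]scale1r -(mulfV nw0) -scalerA linearZr_LR /= zu mulr0.
  apply/eqP; rewrite -normr_le0; apply/ler_addgt0Pr => e e0; rewrite add0r.
  have e20 : 0 < e / 2 by rewrite divr_gt0.
  have [s s0 se] : exists2 s : R, 0 < s & e / 2 = s%:C.
    exists (complex.Re (e / 2)); have := RRe_real (gtr0_real e20) => ee.
    by rewrite -ltcR ee.
    by [].
  have [r r0 Dr] := Fz _ e20.
  have m0 : 0 < Num.min r (s ^+ 2) by rewrite lt_min r0 exprn_gt0.
  have [x [Kx xm]] := Dne _ m0.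
  have zx : `|z - x| < e / 2.
    by apply: (Dr x); apply: (Dmono _ _ _ _ (conj Kx xm)); rewrite ge_min lexx.
  have Kxu : K (x - hdot x u *: u) by rewrite /K /= phiB phiZ phiu mulr0 subr0.
  have xu : `|hdot x u| <= e / 2.
    rewrite -(@ler_pXn2r _ 2) ?nnegrE// ?(ltW e20)//.
    have := dKC _ Kxu; rewrite proj_norm// lerBrDl -lerBrDr => h.
    apply: le_trans h _; rewrite se -qE -rmorphB -rmorphXn /= lecR lerBlDl.
    by apply/ltW/(lt_le_trans xm); rewrite lerD2l ge_min lexx orbT.
  rewrite -(subrK x z) linearDl (le_trans (ler_normD _ _))// [leRHS]splitr.
  by rewrite lerD// (le_trans (unit_CS _ u1))// ltW.
have zz : hdot z z != 0.
  rewrite dnorm_eq0; apply/eqP => z0; move: phi_z.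
  by rewrite z0 -(scale0r 0) phiZ mul0r => /eqP; rewrite eq_sym oner_eq0.
exists ((hdot z z)^-1 *: z) => x.
have : hdot z (x - phi x *: z) = 0.
  by apply: orth; rewrite phiB phiZ phi_z mulr1 subrr.
rewrite hermC expr0 mul1r => /eqP; rewrite conjC_eq0.
rewrite linearBl linearZl_LR /= subr_eq0 => /eqP xz.
rewrite linearZr_LR /= xz geC0_conj ?invr_ge0 ?dnorm_ge0//.
by rewrite mulrC mulfK.
Qed.

(* Well defined on bounded linear operators by adjointP. *)
Definition adjoint T : H -> H :=
  xget (fun=> 0) [set S | forall x y, hdot (T x) y = hdot x (S y)].

Lemma adjointP T : linear T -> continuous T ->
  forall x y, hdot (T x) y = hdot x (adjoint T y).
Proof.
move=> linT cT.
suff : exists S, forall x y, hdot (T x) y = hdot x (S y).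
  by move/(xgetPex (fun=> 0)).
suff /choice[S TS] : forall y, exists z, forall x, hdot (T x) y = hdot x z.
  by exists S => x y.
move=> y.
pose L := GRing.isLinear.Build C H H *:%R T linT.
pose Tl : {linear H -> H} := HB.pack T L.
have /linear_bounded_continuous/linear_boundedP : continuous Tl by [].
move=> [M [Mr /(_ (M + 1))]]; rewrite ltrDl ltr01 => /(_ isT) TM.
have [->|y0] := eqVneq y 0.
  by exists 0 => x; rewrite !linear0r.
have ny0 : `|y| != 0 by rewrite normr_eq0.
apply: (@riesz _ (`|y| * (M + 1))).
  by move=> a u v; rewrite linT linearPl.
move=> x.
have {1}-> : y = `|y| *: (`|y|^-1 *: y) by rewrite scalerA mulfV ?scale1r.
rewrite linearZr_LR /= geC0_conj// normrM normr_id -mulrA.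
apply: ler_wpM2l => //; apply: le_trans (TM x); apply: unit_CS.
by rewrite normrZ normfV normr_id mulVf.
Qed.

(* Only meant for positive operators T, for which every term is nonnegative and
   the sum does not depend on the orthonormal basis. *)
Definition trace T : \bar R := \esum_(e in onb) (complex.Re (hdot (T e) e))%:E.

Definition hs_norm T : \bar R := sqrte (trace (adjoint T \o T)).

(* For linear maps between normed spaces, continuous means bounded, see
   linear_bounded_continuous. *)
Definition hilbert_schmidt T :=
  [/\ linear T, continuous T & (hs_norm T < +oo)%E].

(* expi t is e^(i t). *)
Definition expi (t : R) : C := cos t +i* sin t.

Definition w2 (nu : R) T : \bar R :=
  ereal_sup (range (fun t : R =>
    hs_norm ((nu%:C * expi t) *: T + ((1 - nu)%:C * expi (- t)) *: adjoint T))).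

Definition op_mx (A B C D : H -> H) (x : hsum H H) : hsum H H :=
  (A x.1 + B x.2, C x.1 + D x.2).
End operators.

(* Main.v *)
Require Import Defs.
From HB Require Import structures.
From mathcomp Require Import all_boot all_order all_algebra.
From mathcomp Require Import finmap ring lra.
From mathcomp Require Import all_classical all_reals.
From mathcomp Require Import ereal topology normedtype esum trigo.
From mathcomp Require Import complex.

Set Implicit Arguments.
Unset Strict Implicit.
Unset Printing Implicit Defensive.

Import Order.TTheory GRing.Theory Num.Theory.
Import numFieldNormedType.Exports.

Local Open Scope classical_set_scope.
Local Open Scope ring_scope.

(** The square of the Hilbert-Schmidt norm is the sum of the squares of the
norms of the columns in an orthonormal basis, and this sum behaves well for
block operators: if M has blocks A, B, C, D then
  |M|^2 = |A|^2 + |B|^2 + |C|^2 + |D|^2             ([sum_sqr_op_mx]).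
The operator nu e^(it) M + (1 - nu) e^(-it) M^* is again a block operator.  Its
diagonal blocks are the same expressions formed from A and from D, so their
squared norms are at most w2(A)^2 and w2(D)^2.  Its off-diagonal blocks are
nu e^(it) B + (1 - nu) e^(-it) C^* and nu e^(it) C + (1 - nu) e^(-it) B^*.  The
square of the norm is convex and an operator has the norm of its adjoint, so the
first block contributes at most nu |B|^2 + (1 - nu) |C|^2 ([sum_sqr_convex]),
the second at most nu |C|^2 + (1 - nu) |B|^2, and the two weights of |B|^2, like
those of |C|^2, add up to 1.

The block formula compares the basis chosen for the sum of two copies of H with
the one chosen for H.  What makes this possible is that
  sum_e |T e|^2 = sum_e sum_f |(T e, f)|^2 = sum_f |T^* f|^2
with e and f running through the bases of the source and of the target
([sum_sqr_adjoint]): the row operator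
(x1, x2) |-> A x1 + B x2 is traded for its adjoint y |-> (A^* y, B^* y), which
lives on H and whose columns are split by Pythagoras.  The displayed identity
rests on Parseval's identity for a maximal orthonormal set of arbitrary
cardinality ([parseval]). *)

(** * Real-valued norms *)

Section real_norm.
Variable R : realType.
Local Notation C := R[i].

(** The norms at hand take values in the complex numbers; having them in R makes
suprema, infima and linear arithmetic available. *)
Definition rnorm (V : normedZmodType C) (x : V) : R := complex.Re `|x|.

Lemma rnormE (V : normedZmodType C) (x : V) : (rnorm x)%:C%C = `|x|.
Proof. by rewrite /rnorm RRe_real// ger0_real. Qed.

Lemma rnorm_ge0 (V : normedZmodType C) (x : V) : 0 <= rnorm x.
Proof. by rewrite -lecR rnormE normr_ge0. Qed.

Lemma rnormD (V : normedZmodType C) (x y : V) :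
  rnorm (x + y) <= rnorm x + rnorm y.
Proof. by rewrite -lecR rmorphD /= !rnormE ler_normD. Qed.

Lemma rnormB (V : normedZmodType C) (x y : V) :
  rnorm (x - y) <= rnorm x + rnorm y.
Proof. by rewrite -lecR rmorphD /= !rnormE ler_normB. Qed.

Lemma rnormZ (V : normedModType C) (a : C) (x : V) :
  rnorm (a *: x) = rnorm a * rnorm x.
Proof. by apply: (@complexI R); rewrite rmorphM /= !rnormE normrZ. Qed.

Lemma rnorm_conj (a : C) : rnorm (Num.conj a) = rnorm a.
Proof. by rewrite /rnorm norm_conjC. Qed.

Lemma hdot_rnorm (H : hilbertType R) (x : H) :
  hdot x x = (rnorm x ^+ 2)%:C%C.
Proof. by rewrite rmorphXn /= rnormE hdot_norm. Qed.

Lemma hdotC (H : hilbertType R) (x y : H) :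
  hdot x y = Num.conj (hdot y x).
Proof. by rewrite hermC expr0 mul1r. Qed.

(** The triangle inequality followed by convexity of the square, whose defect
is nu (1 - nu) (|x| - |y|)^2. *)
Lemma rnorm_convex (H : hilbertType R) (nu : R) (a b : C) (x y : H) :
  0 <= nu <= 1 -> rnorm a = nu -> rnorm b = 1 - nu ->
  rnorm (a *: x + b *: y) ^+ 2 <=
  nu * rnorm x ^+ 2 + (1 - nu) * rnorm y ^+ 2.
Proof.
move=> /andP[nu0 nu1] an bn.
apply: le_trans (_ : (nu * rnorm x + (1 - nu) * rnorm y) ^+ 2 <= _).
  rewrite ler_pXn2r ?nnegrE ?rnorm_ge0//; last first.
    by rewrite addr_ge0// mulr_ge0 ?rnorm_ge0// subr_ge0.
  by rewrite -bn -{1}an -!rnormZ rnormD.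
rewrite -subr_ge0.
rewrite [leRHS](_ : _ = nu * (1 - nu) * (rnorm x - rnorm y) ^+ 2); last by ring.
by apply: mulr_ge0; [apply: mulr_ge0; rewrite ?subr_ge0|exact: sqr_ge0].
Qed.

End real_norm.

(** * Parseval's identity in a Hilbert space of any dimension *)

Section parseval.
Variables (R : realType) (H : hilbertType R) (E : set H).
Hypothesis oE : orthonormal_set E.
Implicit Types (x : H) (F G : {fset H}).

Definition residual x F : H := x - \sum_(e <- F) hdot x e *: e.

Lemma hdot_residual x F f : [set` F] `<=` E -> E f ->
  hdot (residual x F) f = if f \in F then 0 else hdot x f.
Proof.
move=> FE Ef; rewrite /residual linearBl linear_sumlz.
rewrite (eq_big_seq (fun e => hdot x e * (e == f)%:R)); last first.
  by move=> e /FE Ee; rewrite linearZl_LR /= (oE Ee Ef).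
case: ifPn => fF.
  rewrite (big_fsetD1 f)//= eqxx mulr1 big1_seq ?addr0 ?subrr// => e.
  by rewrite !inE => /andP[_ /andP[/negPf -> _]]; rewrite mulr0.
rewrite big1_seq ?subr0// => e /= eF.
suff /negPf -> : e != f by rewrite mulr0.
by apply: contraNneq fF => <-.
Qed.

(** The residual is orthogonal to the members of F, so its inner product with
itself is its inner product with x. *)
Lemma bessel x F : [set` F] `<=` E ->
  rnorm (residual x F) ^+ 2 =
  rnorm x ^+ 2 - \sum_(e <- F) rnorm (hdot x e) ^+ 2.
Proof.
move=> FE; apply: (@complexI R); rewrite -hdot_rnorm {2}/residual linearBr.
rewrite linear_sumr [X in _ - X]big1_seq; last first.
  move=> e /= eF; rewrite linearZr_LR /= hdot_residual// ?eF ?mulr0//.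
  exact: FE.
rewrite subr0 linearBl linear_sumlz rmorphB /= -hdot_rnorm rmorph_sum /=.
congr (_ - _); apply: eq_bigr => e _.
by rewrite linearZl_LR /= (hdotC e) -normCK rmorphXn /= rnormE.
Qed.

(** The one-vector case of the preceding identity, as a norm is nonnegative. *)
Lemma rnorm_hdot_le x e : E e -> rnorm (hdot x e) <= rnorm x.
Proof.
move=> Ee; rewrite -(@ler_pXn2r _ 2) ?nnegrE ?rnorm_ge0// -subr_ge0.
have := @bessel x [fset e]%fset; rewrite big_seq_fset1 => <-.
  exact: exprn_ge0 (rnorm_ge0 _).
by move=> f /=; rewrite inE => /eqP ->.
Qed.

(** Pythagoras: the difference of the residuals is a combination of members of
G, hence orthogonal to the residual for G. *)
Lemma residual_sub x F G : [set` F] `<=` [set` G] -> [set` G] `<=` E ->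
  rnorm (residual x F - residual x G) ^+ 2 =
  rnorm (residual x F) ^+ 2 - rnorm (residual x G) ^+ 2.
Proof.
move=> FG GE.
have orth : hdot (residual x F - residual x G) (residual x G) = 0.
  have -> : residual x F - residual x G =
      \sum_(e <- G) hdot x e *: e - \sum_(e <- F) hdot x e *: e.
    by rewrite /residual opprB addrACA [x + _]addrC addrACA subrr addr0 addrC.
  have rG e : e \in G -> hdot (residual x G) e = 0.
    by move=> eG; rewrite hdot_residual ?eG//; exact: GE.
  rewrite hdotC linearBr !linear_sumr !big1_seq ?subrr ?conjC0// => e /= eF.
    by rewrite linearZr_LR /= rG ?mulr0//; exact: FG.
  by rewrite linearZr_LR /= rG ?mulr0.
apply/(@complexI R)/eqP; rewrite rmorphB /= -!hdot_rnorm eq_sym subr_eq.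
apply/eqP.
rewrite -{1 2}(subrK (residual x G) (residual x F)) dnormD.
by rewrite orth conjC0 !addr0.
Qed.

Hypothesis maxE : forall x, (forall e, E e -> hdot x e = 0) -> x = 0.

(** The residuals whose squared norm is close to the infimum d of all of them
form a Cauchy filter base.  Its limit z is orthogonal to E: adding e to F lowers
the squared norm of the residual r by |(r, e)|^2, which is therefore small when
r is almost minimal.  As E is maximal, z is 0, and the residuals approaching z
are small. *)
Lemma residual_small x (eta : R) : 0 < eta ->
  exists F, [set` F] `<=` E /\ rnorm (residual x F) < eta.
Proof.
move=> eta0.
pose K := [set r | exists2 F : {fset H}, [set` F] `<=` E & r = residual x F].
have KF (F : {fset H}) : [set` F] `<=` E -> K (residual x F) by exists F.
have K0 : K (residual x fset0) by apply: KF => e /=; rewrite inE.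
pose sq (r : H) := rnorm r ^+ 2.
have hi : has_inf (sq @` K).
  split; first by exists (sq (residual x fset0)), (residual x fset0).
  by exists 0 => _ [r _ <-]; exact: sqr_ge0.
pose d := inf (sq @` K).
have dK r : K r -> d <= sq r.
  by move=> Kr; apply: ge_inf; [exact: hi.2|exists r].
pose D e := [set r | K r /\ sq r < d + e ^+ 2].
have Dne e : 0 < e -> D e !=set0.
  move=> e0; have [_ [r Kr <-] rd] := inf_adherent (exprn_gt0 2 e0) hi.
  by exists r.
have Dmono e e' : 0 < e -> e <= e' -> D e `<=` D e'.
  move=> e0 ee' r [Kr re]; split=> //; apply: lt_le_trans re _.
  by rewrite lerD2l ler_pXn2r// ?nnegrE ltW// (lt_le_trans e0).
have DD e r s : 0 < e -> D e r -> D e s -> rnorm (r - s) <= 2 * e.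
  move=> e0 [[F FE ->] re] [[G GE ->] se].
  pose U := (F `|` G)%fset.
  have UE : [set` U] `<=` E.
    by move=> f /=; rewrite inE => /orP[/FE|/GE].
  have dU := dK _ (KF _ UE).
  have FU : [set` F] `<=` [set` U] by move=> f /= fF; rewrite inE fF.
  have GU : [set` G] `<=` [set` U] by move=> f /= fG; rewrite inE fG orbT.
  (* As d is a lower bound of the squared norm for the union too, Pythagoras
     puts both residuals within e of the one for the union. *)
  have close F' : [set` F'] `<=` [set` U] -> sq (residual x F') < d + e ^+ 2 ->
      rnorm (residual x F' - residual x U) <= e.
    move=> F'U F'd; rewrite -(@ler_pXn2r _ 2) ?nnegrE ?rnorm_ge0 ?(ltW e0)//.
    rewrite residual_sub//; move: F'd dU; rewrite /sq; lra.
  have -> : residual x F - residual x G =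
      (residual x F - residual x U) - (residual x G - residual x U).
    by move: (residual x F) (residual x G) (residual x U) => a b u;
      rewrite opprB addrA subrK.
  apply: le_trans (rnormB _ _) _.
  by have := close _ FU re; have := close _ GU se; lra.
pose Fi : set_system H := [set A | exists2 e, 0 < e & D e `<=` A].
have FF : ProperFilter Fi.
  split; first by move=> [e e0 De]; have [r /De] := Dne e e0.
  split; first by exists 1.
    move=> A B [e e0 eA] [f f0 fB].
    have m0 : 0 < Num.min e f by rewrite lt_min e0.
    exists (Num.min e f) => // r Dr; split.
      by apply/eA/(Dmono _ _ _ _ _ Dr); rewrite // ge_min lexx.
    by apply/fB/(Dmono _ _ _ _ _ Dr); rewrite // ge_min lexx orbT.
  by move=> A B AB [e e0 eA]; exists e => //; exact: subset_trans AB.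
have toR (e : R[i]) : 0 < e -> exists2 r : R, 0 < r & e = r%:C%C.
  move=> e0; have ee := RRe_real (gtr0_real e0).
  by exists (complex.Re e) => //; rewrite -ltcR ee.
have Fc : cauchy Fi.
  apply/cauchy_ballP => e /toR[r r0 ->].
  have r30 : 0 < r / 3 by rewrite divr_gt0.
  exists (D (r / 3), D (r / 3)); first by split; exists (r / 3).
  move=> [u v] /= [Du Dv]; rewrite -ball_normE /= -rnormE ltcR.
  by have := DD _ _ _ r30 Du Dv; lra.
move/cauchy_cvg/cvg_ex : Fc => [z /(@cvgrPdist_lt _ _ _ Fi _ id) Fz].
have near (e : R) : 0 < e -> exists r, D e r /\ rnorm (z - r) < e.
  move=> e0; have e0C : 0 < e%:C%C by rewrite ltcR.
  have [s s0 Ds] := Fz _ e0C.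
  have m0 : 0 < Num.min e s by rewrite lt_min e0.
  have [r Dr] := Dne _ m0; exists r; split.
    by apply: (Dmono _ _ _ _ _ Dr); rewrite // ge_min lexx.
  rewrite -ltcR rnormE; apply: Ds.
  by apply: (Dmono _ _ _ _ _ Dr); rewrite // ge_min lexx orbT.
have z0 : z = 0.
  apply: maxE => e Ee; apply/eqP; rewrite -normr_le0 -rnormE lecR.
  apply/ler_addgt0Pr => t t0; rewrite add0r.
  have t20 : 0 < t / 2 by rewrite divr_gt0.
  have [r [[[F FE rE] rd] zr]] := near _ t20.
  have re : rnorm (hdot r e) <= t / 2.
    have [eF|eF] := boolP (e \in F).
      by rewrite rE hdot_residual// eF /rnorm normr0 ltW.
    have UE : [set` (e |` F)%fset] `<=` E.
      by move=> f /=; rewrite !inE => /orP[/eqP ->|/FE].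
    have dU := dK _ (KF _ UE).
    rewrite -(@ler_pXn2r _ 2) ?nnegrE ?rnorm_ge0 ?(ltW t20)//.
    move: rd dU; rewrite /sq rE hdot_residual// (negPf eF) !bessel//.
    by rewrite big_fsetU1//=; lra.
  have -> : hdot z e = hdot (z - r) e + hdot r e by rewrite -linearDl subrK.
  apply: le_trans (rnormD _ _) _.
  by have := rnorm_hdot_le (z - r) Ee; lra.
have [r [[[F FE rE] _]]] := near _ eta0.
rewrite z0 sub0r rE => Fe; exists F; split => //.
by rewrite /rnorm -normrN.
Qed.

(** One inequality is Bessel's, the other one holds up to any t > 0 by taking a
finite subset of E whose residual has squared norm less than t. *)
Lemma parseval x :
  \esum_(e in E) (rnorm (hdot x e) ^+ 2)%:E = (rnorm x ^+ 2)%:E.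
Proof.
apply/eqP; rewrite eq_le; apply/andP; split.
  apply: ge_ereal_sup => _ [A [finA AE] <-].
  rewrite fsbig_finite//= sumEFin lee_fin -subr_ge0 -bessel ?sqr_ge0//.
  by move=> e /=; rewrite in_fset_set// inE => /AE.
apply/lee_addgt0Pr => t t0.
have st0 : 0 < Num.sqrt t by rewrite sqrtr_gt0.
have [F [FE Ft]] := residual_small x st0.
have {}Ft : rnorm (residual x F) ^+ 2 < t.
  by rewrite -[ltRHS]sqr_sqrtr ?ltW// ltr_pXn2r// nnegrE ?rnorm_ge0// ltW.
rewrite (bessel _ FE) ltrBlDr in Ft.
apply: le_trans (_ : ((\sum_(e <- F) rnorm (hdot x e) ^+ 2)%:E + t%:E <= _)%E).
  by rewrite -EFinD lee_fin addrC ltW.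
apply: leeD => //; apply: esum_ge; exists [set` F].
  by split => //; exact: finite_fset.
by rewrite fsbig_finite ?finite_fset//= set_fsetK sumEFin.
Qed.

End parseval.

(** * Squared Hilbert-Schmidt norms through adjoint pairs *)

Section adjoint_pairs.
Variable R : realType.
Implicit Types H K : hilbertType R.

(** Relating T and S by the defining identity, rather than taking the adjoint
of T, allows different source and target spaces, is symmetric, and lets
adjoints of combinations be written down instead of being shown to exist. *)
Definition adjoint_pair H K (T : H -> K) (S : K -> H) :=
  forall x y, hdot (T x) y = hdot x (S y).

Lemma adjoint_pair_sym H K (T : H -> K) (S : K -> H) :
  adjoint_pair T S -> adjoint_pair S T.
Proof. by move=> TS x y; rewrite hdotC -TS -hdotC. Qed.

Lemma adjoint_pair_comb H K (T T' : H -> K) (S S' : K -> H) (a b : R[i]) :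
  adjoint_pair T S -> adjoint_pair T' S' ->
  adjoint_pair (a *: T + b *: T') (Num.conj a *: S + Num.conj b *: S').
Proof.
move=> TS TS' x y /=.
rewrite linearDl linearDr !linearZl_LR !linearZr_LR /= !conjCK.
by rewrite TS TS'.
Qed.

Lemma adjoint_pair_row H K (A B : H -> K) (A' B' : K -> H) :
  adjoint_pair A A' -> adjoint_pair B B' ->
  adjoint_pair (fun x : hsum H H => A x.1 + B x.2)
    (fun y => (A' y, B' y) : hsum H H).
Proof. by move=> AA' BB' x y; rewrite hsum_hdotE linearDl /= AA' BB'. Qed.

Lemma adjoint_pair_op_mx H (A B C D A' B' C' D' : H -> H) :
  adjoint_pair A A' -> adjoint_pair B B' ->
  adjoint_pair C C' -> adjoint_pair D D' ->
  adjoint_pair (op_mx A B C D) (op_mx A' C' B' D').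
Proof.
move=> AA' BB' CC' DD' x y.
rewrite !hsum_hdotE /= !linearDl !linearDr /= AA' BB' CC' DD'.
by rewrite addrACA.
Qed.

Lemma adjoint_unique H (T S : H -> H) : adjoint_pair T S -> adjoint T = S.
Proof.
move=> TS.
have TA : adjoint_pair T (adjoint T).
  by apply: (@xgetPex _ (fun=> 0) [set S | adjoint_pair T S]); exists S.
apply/funext => y; apply/eqP; rewrite -subr_eq0 -(dnorm_eq0 hdot).
by rewrite linearBr /= -TA -TS subrr.
Qed.

(** The square of the Hilbert-Schmidt norm, see [hs_norm_sqr]; source and target
may differ, as is needed for the rows and columns of a block operator. *)
Definition sum_sqr H K (T : H -> K) : \bar R :=
  \esum_(e in @onb R H) (rnorm (T e) ^+ 2)%:E.

Lemma sum_sqr_ge0 H K (T : H -> K) : (0 <= sum_sqr T)%E.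
Proof. by apply: esum_ge0 => e _; rewrite lee_fin sqr_ge0. Qed.

(** Both sides are the sum of |(T e, f)|^2 over e and f, by Parseval's identity
in the target of each operator; nonnegative families can be summed in any
order. *)
Lemma sum_sqr_adjoint H K (T : H -> K) (S : K -> H) :
  adjoint_pair T S -> sum_sqr T = sum_sqr S.
Proof.
move=> TS; rewrite /sum_sqr.
have [oE maxE] := @onbP R H; have [oF maxF] := @onbP R K.
under eq_esum => e _ do rewrite -(parseval oF maxF).
under [RHS]eq_esum => f _ do rewrite -(parseval oE maxE).
rewrite !esum_esum; try by move=> *; rewrite lee_fin sqr_ge0.
rewrite (reindex_esum (@onb R K `*`` fun=> @onb R H) _
  (fun p => (p.2, p.1))) /=.
  by apply: eq_esum => -[f e] _ /=; rewrite TS hdotC rnorm_conj.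
split.
- by move=> [f e] [].
- by move=> [f e] [f' e'] _ _ /= [-> ->].
- by move=> [e f] [Ee Ff]; exists (f, e).
Qed.

Lemma sum_sqr_col H K (S T : H -> K) :
  sum_sqr (fun x => (S x, T x) : hsum K K) = (sum_sqr S + sum_sqr T)%E.
Proof.
rewrite /sum_sqr -esumD; try by move=> *; rewrite lee_fin sqr_ge0.
apply: eq_esum => e _; rewrite -EFinD; congr EFin.
by apply: (@complexI R); rewrite rmorphD /= -!hdot_rnorm hsum_hdotE.
Qed.

(** The sum on the left runs over the basis chosen for the direct sum, which need
not consist of vectors of the two summands; passing to the adjoint, which is a
column operator defined on K, avoids that basis. *)
Lemma sum_sqr_row H K (A B : H -> K) (A' B' : K -> H) :
  adjoint_pair A A' -> adjoint_pair B B' ->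
  sum_sqr (fun x : hsum H H => A x.1 + B x.2) =
  (sum_sqr A + sum_sqr B)%E.
Proof.
move=> AA' BB'.
rewrite (sum_sqr_adjoint (adjoint_pair_row AA' BB')).
by rewrite sum_sqr_col (sum_sqr_adjoint AA') (sum_sqr_adjoint BB').
Qed.

Lemma sum_sqr_op_mx H (A B C D A' B' C' D' : H -> H) :
  adjoint_pair A A' -> adjoint_pair B B' ->
  adjoint_pair C C' -> adjoint_pair D D' ->
  sum_sqr (op_mx A B C D) =
  (sum_sqr A + sum_sqr B + (sum_sqr C + sum_sqr D))%E.
Proof.
move=> AA' BB' CC' DD'.
by rewrite /op_mx sum_sqr_col (sum_sqr_row AA' BB') (sum_sqr_row CC' DD').
Qed.

Lemma sum_sqr_convex H (nu : R) (a b : R[i]) (S T : H -> H) :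
  0 <= nu <= 1 -> rnorm a = nu -> rnorm b = 1 - nu ->
  (sum_sqr (a *: S + b *: T)%R <=
   nu%:E * sum_sqr S + (1 - nu)%:E * sum_sqr T)%E.
Proof.
move=> nu01 an bn; have /andP[nu0 nu1] := nu01.
apply: ge_ereal_sup => _ [A [finA AE] <-].
apply: le_trans (_ : (\sum_(e \in A) (nu%:E * (rnorm (S e) ^+ 2)%:E +
  (1 - nu)%:E * (rnorm (T e) ^+ 2)%:E) <= _)%E).
  apply: lee_fsum => // e Ae.
  by rewrite -!EFinM -EFinD lee_fin; exact: rnorm_convex.
rewrite fsbig_split//= -!ge0_mule_fsumr;
  try by move=> *; rewrite lee_fin sqr_ge0.
by apply: leeD; apply: lee_wpmul2l; rewrite ?lee_fin ?subr_ge0//;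
  apply: ereal_sup_ubound; exists A.
Qed.

Lemma hs_norm_ge0 H (T : H -> H) : (0 <= hs_norm T)%E.
Proof. exact: sqrte_ge0. Qed.

Lemma hs_norm_sqr H (T S : H -> H) : adjoint_pair T S ->
  (hs_norm T ^+ 2)%E = sum_sqr T.
Proof.
move=> TS; have traceE : trace (adjoint T \o T) = sum_sqr T.
  apply: eq_esum => e _ /=; rewrite (adjoint_unique TS).
  by rewrite (adjoint_pair_sym TS) hdot_rnorm.
by rewrite /hs_norm traceE sqr_sqrte// sum_sqr_ge0.
Qed.

End adjoint_pairs.

(** * Bounding the weighted numerical radius *)

Section w2_facts.
Variables (R : realType) (H : hilbertType R).
Implicit Types T : H -> H.

Lemma lee_sqr (x y : \bar R) : (0 <= x)%E -> (x <= y)%E -> (x ^+ 2 <= y ^+ 2)%E.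
Proof. by move=> x0 xy; rewrite !expe2 lee_pmul. Qed.

Definition weighted_part nu t T : H -> H :=
  (nu%:C%C * expi t) *: T + ((1 - nu)%:C%C * expi (- t)) *: adjoint T.

Lemma hs_norm_le_w2 nu T t :
  (hs_norm (weighted_part nu t T) <= w2 nu T)%E.
Proof. by apply: ereal_sup_ubound; exists t. Qed.

Lemma w2_sqr_le nu T (M : \bar R) :
  (forall t, hs_norm (weighted_part nu t T) ^+ 2 <= M)%E ->
  (w2 nu T ^+ 2 <= M)%E.
Proof.
move=> TM.
have M0 : (0 <= M)%E by apply: le_trans (TM 0); rewrite expe_ge0// hs_norm_ge0.
rewrite -(sqr_sqrte M0); apply: lee_sqr.
  exact: le_trans (hs_norm_ge0 _) (hs_norm_le_w2 nu T 0).
apply: ge_ereal_sup => _ [t _ <-].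
rewrite -[leLHS]gee0_abs ?hs_norm_ge0// -sqrte_sqr lee_sqrt//; exact: TM.
Qed.

Lemma rnorm_expi (r t : R) : 0 <= r -> rnorm (r%:C%C * expi t) = r.
Proof.
move=> r0; rewrite /rnorm normrM !normc_def /= cos2Dsin2 sqrtr1 expr0n addr0.
by rewrite sqrtr_sqr ger0_norm// mulr1 mul0r subr0.
Qed.

Lemma hilbert_schmidt_adjoint T :
  hilbert_schmidt T -> adjoint_pair T (adjoint T).
Proof. by move=> [linT cT _] x y; exact: adjointP. Qed.

End w2_facts.

Theorem theorem3p9 (R : realType) (H : hilbertType R) (A B C D : H -> H)
    (nu : R) :
  hilbert_schmidt A -> hilbert_schmidt B ->
  hilbert_schmidt C -> hilbert_schmidt D ->
  0 <= nu <= 1 ->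
  (w2 nu (op_mx A B C D) ^+ 2 <=
   w2 nu A ^+ 2 + w2 nu D ^+ 2 + hs_norm B ^+ 2 + hs_norm C ^+ 2)%E.
Proof.
move=> /hilbert_schmidt_adjoint aA /hilbert_schmidt_adjoint aB.
move=> /hilbert_schmidt_adjoint aC /hilbert_schmidt_adjoint aD nu01.
have /andP[nu0 nu1] := nu01.
apply: w2_sqr_le => t.
rewrite /weighted_part (adjoint_unique (adjoint_pair_op_mx aA aB aC aD)).
have := hs_norm_le_w2 nu A t; have := hs_norm_le_w2 nu D t.
rewrite /weighted_part.
have := rnorm_expi t nu0; have := @rnorm_expi _ (1 - nu) (- t).
rewrite subr_ge0 => /(_ nu1).
set a := (nu%:C%C * _); set b := (_%:C%C * _) => bn an wD wA.
have -> : a *: op_mx A B C D +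
    b *: op_mx (adjoint A) (adjoint C) (adjoint B) (adjoint D) =
    op_mx (a *: A + b *: adjoint A) (a *: B + b *: adjoint C)
          (a *: C + b *: adjoint B) (a *: D + b *: adjoint D).
  by apply/funext => x; congr pair; rewrite /= !scalerDr addrACA.
have aA' := adjoint_pair_comb a b aA (adjoint_pair_sym aA).
have aB' := adjoint_pair_comb a b aB (adjoint_pair_sym aC).
have aC' := adjoint_pair_comb a b aC (adjoint_pair_sym aB).
have aD' := adjoint_pair_comb a b aD (adjoint_pair_sym aD).
rewrite (hs_norm_sqr (adjoint_pair_op_mx aA' aB' aC' aD')).
rewrite (sum_sqr_op_mx aA' aB' aC' aD') -(hs_norm_sqr aA') -(hs_norm_sqr aD').
(* B gets the weight nu from the upper right block and 1 - nu from the lower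
   left one, C the other way round. *)
have BC : (sum_sqr (a *: B + b *: adjoint C)%R +
    sum_sqr (a *: C + b *: adjoint B)%R <= hs_norm B ^+ 2 + hs_norm C ^+ 2)%E.
  apply: le_trans (leeD (sum_sqr_convex _ _ nu01 an bn)
    (sum_sqr_convex _ _ nu01 an bn)) _.
  have -> := sum_sqr_adjoint (adjoint_pair_sym aB).
  have -> := sum_sqr_adjoint (adjoint_pair_sym aC).
  rewrite (hs_norm_sqr aB) (hs_norm_sqr aC).
  rewrite [X in (_ + X)%E]addeC addeACA -!ge0_muleDl ?lee_fin ?subr_ge0//.
  by rewrite -!EFinD [(nu + _)%R]addrC subrK !mul1e.
apply: le_trans (_ : ((hs_norm (a *: A + b *: adjoint A)%R ^+ 2 +
  hs_norm (a *: D + b *: adjoint D)%R ^+ 2) +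
  (sum_sqr (a *: B + b *: adjoint C)%R +
    sum_sqr (a *: C + b *: adjoint B)%R) <= _)%E).
  by rewrite [X in (_ + X <= _)%E]addeC addeACA.
rewrite -[leRHS]addeA; apply: leeD BC.
by apply: leeD; apply: lee_sqr => //; exact: hs_norm_ge0.
Qed.
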